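(* Let $G$ be a simple graph with $n$ vertices and algebraic connectivity $\lambda_2(G)\ge\gamma n$ for some $\gamma>0$. Let $G_1$ be the graph which arises from $G$ by removing the vertex $v_1$ and all edges adjacent to it. Then there is a constant $c>0$ depending only on $\gamma$ such that $$t(G_1)\ \ge\ \frac{t(G)}{c\,n},$$ where $t(G)$ denotes the number of spanning trees of the graph $G$.
   Context: A simple graph is an undirected graph without loops and multiple edges. The Laplacian matrix $Q(G)$ of a simple graph with vertices $v_1,\dots,v_n$ is the $n\times n$ matrix with $Q_{jj}=d_j$ (the degree of $v_j$), $Q_{jk}=-1$ if $\{v_j,v_k\}$ is an edge, and $Q_{jk}=0$ otherwise. Its eigenvalues are $0=\lambda_1\le\lambda_2\le\dots\le\lambda_n$, and $\lambda_2(G)$ is the algebraic connectivity of $G$.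
   Formalization: The claim fails for the path on 3 vertices with its middle vertex removed and γ = 1/3 (then t(G_1)=0), so when γn ≤ 1 it is additionally assumed that G_1 is connected; n ≥ 2 is assumed so that λ_2 is defined. *)

(* Defs.v *)
From HB Require Import structures.
From mathcomp Require Import all_boot all_order all_algebra.
From mathcomp Require Import boolp reals.
From mathcomp Require Import polyrcf.

Set Implicit Arguments.
Unset Strict Implicit.
Unset Printing Implicit Defensive.

Import Order.TTheory GRing.Theory Num.Theory.
Local Open Scope ring_scope.

(* A simple graph on the vertex set 'I_n is a set of two-element subsets of   *)
(* 'I_n, so that the simple graphs on 'I_n form a finite type.                *)
Record sgraph (n : nat) := SGraph {
  edges : {set {set 'I_n}};
  edges_card2 : [forall e in edges, #|e| == 2]
}.

HB.instance Definition _ (n : nat) := [isSub for @edges n].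
HB.instance Definition _ (n : nat) := [Countable of sgraph n by <:].
HB.instance Definition _ (n : nat) := [Finite of sgraph n by <:].

Definition adj (n : nat) (G : sgraph n) : rel 'I_n :=
  fun i j => [set i; j] \in edges G.

Definition degree (n : nat) (G : sgraph n) (i : 'I_n) : nat :=
  #|[set j | adj G i j]|.

Definition laplacian (R : realType) (n : nat) (G : sgraph n) : 'M[R]_n :=
  \matrix_(i, j) if i == j then (degree G i)%:R
                 else if adj G i j then - 1 else 0.

(* rootsR lists the distinct real roots in increasing order; each is repeated *)
(* according to its multiplicity in the characteristic polynomial. When all   *)
(* eigenvalues of A are real, as for a symmetric A, the list has length n.    *)
Definition spectrum (R : realType) (n : nat) (A : 'M[R]_n) : seq R :=
  let p := char_poly A in flatten [seq nseq (mup x p) x | x <- rootsR p].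

(* Positions are counted from 0, so this is the second smallest eigenvalue;   *)
(* it is meaningful only for n >= 2.                                          *)
Definition algebraic_connectivity (R : realType) (n : nat) (G : sgraph n) : R :=
  (spectrum (laplacian R G))`_1.

Definition connected (n : nat) (G : sgraph n) : bool :=
  [forall i, forall j, connect (adj G) i j].

(* ucycle also holds of [:: i; j] when ij is an edge, hence the size bound.   *)
Definition acyclic (n : nat) (G : sgraph n) : Prop :=
  forall s : seq 'I_n, (2 < size s)%N -> ~ ucycle (adj G) s.

Definition is_tree (n : nat) (G : sgraph n) : Prop := connected G /\ acyclic G.

Definition spanning_trees (n : nat) (G : sgraph n) : {set sgraph n} :=
  [set T | (edges T \subset edges G) && `[< is_tree T >]].

Definition nb_spanning_trees (n : nat) (G : sgraph n) : nat :=
  #|spanning_trees G|.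

(* lift v : 'I_n.-1 -> 'I_n is the increasing enumeration of the vertices     *)
(* other than v.                                                              *)
Lemma remove_vertex_subproof (n : nat) (G : sgraph n) (v : 'I_n) :
  [forall e in [set e : {set 'I_n.-1} | lift v @: e \in edges G], #|e| == 2].
Proof.
apply/forall_inP => e; rewrite inE => eG.
rewrite -(card_imset (mem e) (@lift_inj _ v)).
exact: (forall_inP (edges_card2 G)).
Qed.

Definition remove_vertex (n : nat) (G : sgraph n) (v : 'I_n) : sgraph n.-1 :=
  SGraph (remove_vertex_subproof G v).

(* Main.v *)
From mathcomp Require Import all_boot all_order all_algebra.
From mathcomp Require Import sesquilinear spectral.
From mathcomp Require Import polyrcf complex.
From mathcomp Require Import boolp reals sequences exp.
From mathcomp Require Import zify ring lra.
Require Import Defs.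

(** Write H for a set of edges on a vertex set V and S for a set of roots. The
    pair (H, S) is a rooted forest when every vertex is H-connected to a point
    of S and |H| + |S| = |V|; the number |V| is the least that |H| + |S| can be
    for a set S met by every component of H ([spans_card]), so each component
    then carries exactly one root and H has no cycle. Let r_k be the number of
    rooted forests of the graph G_1, left after the removal of v_1, that have k
    roots, and let m = n - 1.

    Deleting v_1 from a spanning tree of G and turning its neighbours into
    roots yields a rooted forest of G_1 that determines the tree, so t(G) is at
    most the sum of the r_k ([nb_spanning_trees_le_forests]); and
    r_1 <= m t(G_1), since a forest with one root is a tree with a marked vertex
    ([rooted_forests1_le_trees]). It remains to bound r_k by a multiple of r_1.

    Suppose that G_1 expands: every vertex set A sends at least b |A| |V - A|
    edges to its complement. Joining a root r to a vertex w of another component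
    by an edge of G_1, and no longer counting r as a root, makes a forest with k
    roots out of one with k + 1, and each result arises at most m times
    ([graft_count]). For the number of choices of (r, w), observe that moving
    the root inside its component is a symmetry of the set of rooted forests
    ([rooted_forests_reroot]), so the degree of r out of its component C may be
    replaced by its average over C, which is at least b (m - |C|). Summing over
    the k + 1 components gives at least b m k choices, whence
    b k r_{k+1} <= r_k. Thus r_{k+1} <= r_1 (1/b)^k / k!, and the r_k sum to at
    most r_1 exp(1/b).

    The expansion comes from the spectral gap. By the spectral theorem the
    quadratic form of the Laplacian of G is at least lambda_2 |x|^2 on the
    vectors x orthogonal to the constants ([rayleigh_ge]). The vector equal to
    |B| on A, to -|A| on the complement B of A in G_1, and to 0 at v_1 gives
    m e(A, B) >= (lambda_2 - 1) |A| |B|, where e(A, B) counts the edges of G_1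
    between A and B ([remove_vertex_cut]). When gamma n >= 2 this is expansion
    with b = gamma / 2. When gamma n < 2 the graph G_1 is still connected, by
    the same inequality if gamma n > 1 and by hypothesis otherwise, so
    e(A, B) >= 1, which is expansion with b = gamma^2 / 4 because
    |A| |B| <= n^2 < 4 / gamma^2. *)
Import Order.TTheory GRing.Theory Num.Theory.

Set Implicit Arguments.
Unset Strict Implicit.
Unset Printing Implicit Defensive.

(** * Edge sets connecting every vertex to a set of roots *)
Section Spanning.
Variable V : finType.
Implicit Types (H E : {set {set V}}) (S : {set V}).

Definition eadj H : rel V := fun x y => [set x; y] \in H.

Lemma eadj_sym H : symmetric (eadj H).
Proof. by move=> x y; rewrite /eadj setUC. Qed.

Lemma econnect_sym H : connect_sym (eadj H).
Proof. exact/sym_connect_sym/eadj_sym. Qed.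

Lemma econnectS H H' :
  H \subset H' -> subrel (connect (eadj H)) (connect (eadj H')).
Proof.
move=> /subsetP sHH'; apply: connect_sub => x y xy.
exact/connect1/sHH'.
Qed.

(** Following a walk from x until it first uses the edge ab, one has reached an
    endpoint of ab without using it. *)
Lemma econnect_delete H (a b x y : V) : connect (eadj H) x y ->
  connect (eadj (H :\ [set a; b])) x y \/
  exists2 z, z \in [set a; b] & connect (eadj (H :\ [set a; b])) x z.
Proof.
move=> /connectP[p]; elim: p x => [|z p IHp] x /=.
  by move=> _ ->; left; exact: connect0.
move=> /andP[xz zp] yE.
have [xzE|xzNE] := eqVneq [set x; z] [set a; b].
  by right; exists x; rewrite ?connect0 // -xzE set21.
have step : connect (eadj (H :\ [set a; b])) x z.
  by apply: connect1; rewrite /eadj in_setD1 xzNE.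
by have [zy|[t tab zt]] := IHp z zp yE; [left|right; exists t => //];
  apply: connect_trans step _.
Qed.

Lemma connect_crossing (e : rel V) (S : {set V}) x y :
  connect e x y -> x \notin S -> y \in S ->
  exists a b, [/\ a \notin S, b \in S & e a b].
Proof.
move=> /connectP[p]; elim: p x => [|z p IHp] x /=.
  by move=> _ -> /negP.
move=> /andP[xz zp] yE xS yS.
have [zS|zS] := boolP (z \in S); first by exists x, z.
exact: IHp zp yE zS yS.
Qed.

Definition spans H S := [forall v, [exists s in S, connect (eadj H) v s]].

Lemma spansP H S :
  reflect (forall v, exists2 s, s \in S & connect (eadj H) v s) (spans H S).
Proof. by apply: (iffP forallP) => h v; apply/exists_inP; exact: h. Qed.

(** Contracting an edge ab that leaves S, with b in S: remove it from H and
    promote a to a root. The pair still spans and S has grown, so one ends with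
    every vertex a root. Both extremal properties of rooted forests below follow
    by this induction, because |H| + |S| is unchanged by the step. *)
Lemma spans_ind (P : {set {set V}} -> {set V} -> Prop) :
  (forall H, P H setT) ->
  (forall H S a b, a \notin S -> b \in S -> [set a; b] \in H ->
     P (H :\ [set a; b]) (a |: S) -> P H S) ->
  forall H S, spans H S -> P H S.
Proof.
move=> PT Pstep H S; have [k] := ubnP #|~: S|.
elim: k => // k IHk in H S * => Sk spHS.
have [->//|SNT] := eqVneq S setT.
have [w _ wS] : exists2 w, w \in [set: V] & w \notin S.
  by apply/subsetPn; rewrite subTset.
have /spansP/(_ w)[s sS ws] := spHS.
have [a [b [aS bS ab]]] := connect_crossing ws wS sS.
apply: (Pstep _ _ _ _ aS bS ab); apply: IHk.
  apply: leq_trans (_ : #|~: S| <= k); last by rewrite -ltnS.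
  rewrite setCU setIC -setDE [leqRHS](cardsD1 a) inE aS.
  rewrite ltnS; apply: subset_leq_card; apply/subsetP => z.
  by rewrite !inE andbC.
apply/spansP => v; have /spansP/(_ v)[t tS vt] := spHS.
have [vt'|[z]] := econnect_delete a b vt.
  by exists t => //; rewrite in_setU1 tS orbT.
by rewrite !inE => zab vz; exists z => //; rewrite in_setU1;
  case/orP: zab => /eqP->; rewrite ?eqxx ?bS ?orbT.
Qed.

Lemma spans_card H S : spans H S -> #|V| <= #|H| + #|S|.
Proof.
move: H S; apply: spans_ind => [H|H S a b aS bS ab].
  by rewrite cardsT leq_addl.
by rewrite cardsU1 aS [#|H|](cardsD1 [set a; b]) ab addnCA addnA.
Qed.

Lemma spans_subforest H S : spans H S ->
  exists H0, [/\ H0 \subset H, spans H0 S & #|H0| + #|S| = #|V|].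
Proof.
move=> spHS; suff [H0 [sH spH0 cH0]] :
  exists H0, [/\ H0 \subset H, spans H0 S & #|H0| + #|S| <= #|V|].
  by exists H0; split=> //; apply/eqP; rewrite eqn_leq cH0 spans_card.
move: H S spHS; apply: spans_ind => [H|H S a b aS bS ab [H0 [sH spH0 cH0]]].
  exists set0; rewrite sub0set cards0 cardsT; split=> //.
  by apply/spansP => v; exists v; rewrite ?inE ?connect0.
exists ([set a; b] |: H0); split.
- rewrite subUset sub1set ab /=; apply: subset_trans sH _; exact: subsetDl.
- have sH0 := econnectS (subsetUr [set [set a; b]] H0).
  apply/spansP => v; have /spansP/(_ v)[s] := spH0.
  rewrite in_setU1 => /orP[/eqP->|sS] vs; last by exists s => //; exact: sH0.
  exists b => //; apply: connect_trans (sH0 _ _ vs) _; apply: connect1.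
  by rewrite /eadj in_setU1 eqxx.
- apply: leq_trans cH0; rewrite !cardsU1 aS; case: (_ \in _) => /=; lia.
Qed.

End Spanning.

(** * Counting rooted forests *)
Section RootedForests.
Variables (V : finType) (E : {set {set V}}).
Implicit Types (H : {set {set V}}) (S : {set V}).

(** By [spans_card] the cardinality condition says that H is as small as
    possible; this is how acyclicity of H and uniqueness of the root of each
    component are both encoded. *)
Definition rooted_forest (F : {set {set V}} * {set V}) :=
  [&& F.1 \subset E, spans F.1 F.2 & #|F.1| + #|F.2| == #|V|].

Definition rooted_forests k :=
  [set F | rooted_forest F & #|F.2| == k].

(** If two roots were connected, one of them could be dropped, against the
    minimality of |H| + |S|. *)
Lemma root_uniq F r s : rooted_forest F -> r \in F.2 -> s \in F.2 ->
  connect (eadj F.1) r s -> r = s.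
Proof.
case: F => H S /and3P[/= _ /spansP spHS /eqP cHS] /= rS sS rs.
apply/eqP/negPn/negP => rNs; have : spans H (S :\ r).
  apply/spansP => v; have [t tS vt] := spHS v.
  have [tr|tNr] := eqVneq t r; last by exists t; rewrite // in_setD1 tNr.
  exists s; first by rewrite in_setD1 eq_sym rNs.
  by apply: connect_trans vt _; rewrite tr.
by move=> /spans_card; rewrite -cHS [#|S|](cardsD1 r) rS /=; lia.
Qed.

Lemma rooted_forest_graft H S r w :
  rooted_forest (H, S) -> r \in S -> eadj E r w -> ~~ connect (eadj H) r w ->
  rooted_forest ([set r; w] |: H, S :\ r).
Proof.
move=> FHS rS rwE rwN; have /and3P[/= sHE /spansP spHS /eqP cHS] := FHS.
have sH := econnectS (subsetUr [set [set r; w]] H).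
apply/and3P; split => /=.
- by rewrite subUset sHE andbT sub1set.
- have [t tS wt] := spHS w.
  have tr : t != r.
    by apply: contraNneq rwN => <-; rewrite econnect_sym.
  apply/spansP => v; have [s sS vs] := spHS v.
  have [sr|sNr] := eqVneq s r; last first.
    by exists s; rewrite ?in_setD1 ?sNr //; exact: sH.
  exists t; first by rewrite in_setD1 tr.
  apply: connect_trans (sH _ _ vs) _; apply: connect_trans (sH _ _ wt).
  by apply: connect1; rewrite sr /eadj in_setU1 eqxx.
- have rwNH : [set r; w] \notin H by apply: contra rwN => rwH; exact: connect1.
  by rewrite -cHS cardsU1 rwNH [#|S|](cardsD1 r) rS /=; apply/eqP; lia.
Qed.

Definition outer_nbrs H x := [set y | eadj E x y & ~~ connect (eadj H) x y].

(** The left-hand side counts the ways to attach a root r of a forest with k + 1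
    roots to a vertex w outside its component. From the grafted forest and the
    new edge one recovers the old edge set at once; which endpoint of the edge
    was the root is also determined, since with the new edge removed only one of
    the two endpoints has lost its root. A forest has at most |V| edges. *)
Lemma graft_count k :
  \sum_(F in rooted_forests k.+1) \sum_(r in F.2) #|outer_nbrs F.1 r|
    <= #|V| * #|rooted_forests k|.
Proof.
under eq_bigr => F _ do under eq_bigr => r _ do rewrite -sum1_card.
under eq_bigr => F _ do rewrite pair_big_dep.
rewrite pair_big_dep /= sum1dep_card.
pose f (x : ({set {set V}} * {set V}) * (V * V)) :=
  (([set x.2.1; x.2.2] |: x.1.1, x.1.2 :\ x.2.1), [set x.2.1; x.2.2]).
set Y := [set x | _].
have YP x : x \in Y ->
    [/\ rooted_forest x.1, #|x.1.2| = k.+1, x.2.1 \in x.1.2,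
        eadj E x.2.1 x.2.2 & ~~ connect (eadj x.1.1) x.2.1 x.2.2].
  by rewrite !inE => /andP[/andP[-> /eqP->] /and3P[-> -> ->]].
have fI : {in Y &, injective f}.
  move=> [[H S] [r w]] [[H' S'] [r' w']] /YP[/= FHS cS rS rwE rwN].
  move=> /YP[/= FHS' cS' rS' rwE' rwN'] [].
  move=> eqH eqS eqe.
  have eNH : [set r; w] \notin H by apply: contra rwN => ?; exact: connect1.
  have eNH' : [set r'; w'] \notin H'.
    by apply: contra rwN' => ?; exact: connect1.
  have HE : H = H' by rewrite -(setU1K eNH) -(setU1K eNH') eqH eqe.
  subst H'.
  have rNw : r != w by apply: contraNneq rwN => ->; exact: connect0.
  have rNw' : r' != w' by apply: contraNneq rwN' => ->; exact: connect0.
  have [rr'|rNr'] := eqVneq r r'.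
    subst r'; have -> : S = S' by rewrite -(setD1K rS) eqS setD1K.
    have : w \in [set r; w'] by rewrite -eqe set22.
    by rewrite !inE eq_sym (negPf rNw) => /eqP->.
  (* The two forests would have swapped the roles of r and w; but in the second
     one r is connected to a root other than w, which is also a root of the
     first forest, where r is already the root of the same component. *)
  have r'w : r' = w.
    have : r' \in [set r; w] by rewrite eqe set21.
    by rewrite !inE eq_sym (negPf rNr') => /eqP.
  subst r'; have /and3P[/= _ /spansP/(_ r)[s sS' rs] _] := FHS'.
  have sNw : s != w by apply: contraNneq rwN => <-.
  have : s \in S :\ r by rewrite eqS in_setD1 sNw.
  rewrite in_setD1 => /andP[sNr sS].
  by rewrite (root_uniq FHS rS sS rs) eqxx in sNr.
rewrite -(card_in_imset fI).
pose Z := [set x : ({set {set V}} * {set V}) * {set V} |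
            (x.1 \in rooted_forests k) && (x.2 \in x.1.1)].
apply: (@leq_trans #|Z|).
  apply/subset_leq_card/subsetP =>
    _ /imsetP[[[H S] [r w]] /YP[/= FHS cS rS rwE rwN] ->].
  rewrite !inE /= eqxx rooted_forest_graft //= andbT.
  by move: cS; rewrite (cardsD1 r) rS add1n => -[->].
rewrite -sum1dep_card -(pair_big_dep (mem (rooted_forests k))
  (fun F e => e \in F.1) (fun _ _ => 1)) /= mulnC -sum_nat_const.
apply: leq_sum => F; rewrite sum1_card !inE => /andP[/and3P[_ _ /eqP<-] _].
exact: leq_addr.
Qed.

(** Exchanging the root r with a vertex u of its component is an involution on
    the triples (F, r, u) which leaves the edge set of F unchanged. *)
Lemma rooted_forests_reroot k (M : nmodType)
    (f : {set {set V}} -> V -> V -> M) :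
  (\sum_(F in rooted_forests k) \sum_(r in F.2)
     \sum_(u | connect (eadj F.1) r u) f F.1 r u =
   \sum_(F in rooted_forests k) \sum_(r in F.2)
     \sum_(u | connect (eadj F.1) r u) f F.1 u r)%R.
Proof.
under eq_bigr => F _ do rewrite pair_big_dep.
under [RHS]eq_bigr => F _ do rewrite pair_big_dep.
rewrite !pair_big_dep /=.
pose h (x : ({set {set V}} * {set V}) * (V * V)) :=
  ((x.1.1, x.2.2 |: x.1.2 :\ x.2.1), (x.2.2, x.2.1)).
pose P (x : ({set {set V}} * {set V}) * (V * V)) :=
  [&& x.1 \in rooted_forests k, x.2.1 \in x.1.2 &
      connect (eadj x.1.1) x.2.1 x.2.2].
have hP x : P x -> P (h x) /\ h (h x) = x.
  case: x => [[H S] [r u]] /and3P[/=]; rewrite inE => /andP[FHS /= cS] rS ru.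
  have uNSr : u \notin S :\ r.
    rewrite in_setD1 negb_and negbK; have [//|uNr] := eqVneq u r.
    by apply: contra uNr => uS; rewrite (root_uniq FHS rS uS ru).
  have cS' : #|u |: S :\ r| = #|S| by rewrite cardsU1 uNSr [RHS](cardsD1 r) rS.
  split; last by rewrite /h /= setU1K // setD1K.
  rewrite /P /h /= inE setU11 econnect_sym ru cS' cS !andbT.
  rewrite /rooted_forest /= cS'.
  have /and3P[/= -> /spansP spHS ->] := FHS; rewrite andbT /=.
  apply/spansP => v; have [s sS vs] := spHS v.
  have [sr|sNr] := eqVneq s r; last by exists s; rewrite // !inE sNr sS orbT.
  by exists u; rewrite ?setU11 //; apply: connect_trans vs _; rewrite sr.
rewrite (reindex_onto h h) => [|x Px]; last exact: (hP _ Px).2.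
apply: eq_bigl => x; apply/idP/idP => [/andP[Phx /eqP <-]|Px].
  exact: (hP _ Phx).1.
by have [Phx ->] := hP x Px; rewrite eqxx andbT.
Qed.

End RootedForests.

(** * Forests of an expanding graph *)
Section Expansion.
Variables (V : finType) (E : {set {set V}}) (R : realType) (b : R).
Local Open Scope ring_scope.

Definition expansion := forall A : {set V},
  b * #|A|%:R * #|~: A|%:R
    <= \sum_(x in A) #|[set y | eadj E x y & y \notin A]|%:R :> R.

Hypotheses (b_gt0 : 0 < b) (expE : expansion).

(** The expansion inequality for the component A of r, divided by |A|; all the
    vertices u of A have A as their component. *)
Lemma expansion_component H r :
  b * #|~: [set u | connect (eadj H) r u]|%:R <=
  \sum_(u | connect (eadj H) r u)
     #|outer_nbrs E H u|%:R / #|[set v | connect (eadj H) u v]|%:R.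
Proof.
set A := [set u | _].
have A_gt0 : 0 < #|A|%:R :> R.
  by rewrite ltr0n; apply/card_gt0P; exists r; rewrite inE connect0.
rewrite (eq_bigr (fun u => #|[set y | eadj E u y & y \notin A]|%:R / #|A|%:R)).
  rewrite -mulr_suml ler_pdivlMr // -mulrA [X in _ * X]mulrC mulrA.
  apply: le_trans (expE A) _; rewrite le_eqVlt; apply/orP; left; apply/eqP.
  by apply: eq_bigl => u; rewrite inE.
move=> u ru; congr (_%:R / _%:R); apply: eq_card => y; rewrite !inE.
  by rewrite (same_connect (econnect_sym H) ru).
by rewrite (same_connect (econnect_sym H) ru).
Qed.

(** Components of distinct roots are disjoint. *)
Lemma sum_components_le F : rooted_forest E F ->
  (\sum_(r in F.2) #|[set u | connect (eadj F.1) r u]| <= #|V|)%N.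
Proof.
move=> FF; under eq_bigr => r _ do rewrite cardsE -sum1_card big_mkcond.
rewrite exchange_big /= -[leqRHS]sum1_card; apply: leq_sum => v _.
rewrite -big_mkcondr sum1_card; apply/card_le1_eqP => r s.
move=> /andP[rS rv] /andP[sS sv]; apply: (root_uniq FF) => //.
by apply: (connect_trans (sv : connect _ s v)); rewrite econnect_sym.
Qed.

(** Grafting forests with k + 1 roots: the number of grafts is averaged over the
    position of the root in its component, after which expansion applies to
    each component. The components have total size at most |V|, so that their
    k + 1 complements have total size at least k |V|. *)
Lemma rooted_forests_ratio k : (0 < #|V|)%N ->
  b * k%:R * #|rooted_forests E k.+1|%:R <= #|rooted_forests E k|%:R.
Proof.
move=> V_gt0; have V_gt0R : 0 < #|V|%:R :> R by rewrite ltr0n.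
rewrite -(ler_pM2l V_gt0R) -[leRHS]natrM.
apply: le_trans (_ : (\sum_(F in rooted_forests E k.+1)
    \sum_(r in F.2) #|outer_nbrs E F.1 r|)%:R <= _); last first.
  by rewrite ler_nat graft_count.
(* Spreading the outer degree of r uniformly over its component. *)
pose f H r (u : V) : R :=
  #|outer_nbrs E H r|%:R / #|[set v | connect (eadj H) r v]|%:R.
rewrite natr_sum (_ : \sum_(F in _) _ = \sum_(F in rooted_forests E k.+1)
  \sum_(r in F.2) \sum_(u | connect (eadj F.1) r u) f F.1 r u); last first.
  apply: eq_bigr => F _; rewrite natr_sum; apply: eq_bigr => r _.
  pose A := [set u | connect (eadj F.1) r u].
  rewrite (eq_bigl (fun u => u \in A)) => [|u]; last by rewrite inE.
  rewrite sumr_const -[RHS]mulr_natr /f -/A mulfVK // pnatr_eq0 -lt0n.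
  by apply/card_gt0P; exists r; rewrite inE connect0.
rewrite rooted_forests_reroot [leLHS]mulrA [leLHS]mulr_natr -sumr_const.
apply: ler_sum => F; rewrite inE => /andP[FF /eqP cF].
apply: le_trans (_ : \sum_(r in F.2)
  b * #|~: [set u | connect (eadj F.1) r u]|%:R <= _); last first.
  by apply: ler_sum => r _; exact: expansion_component.
rewrite -mulr_sumr mulrCA ler_pM2l // -natr_sum -natrM ler_nat.
rewrite -(leq_add2r (\sum_(r in F.2) #|[set u | connect (eadj F.1) r u]|)).
rewrite -big_split /= [leqRHS](eq_bigr (fun=> #|V|)) => [|r _]; last first.
  by rewrite addnC cardsC.
by rewrite sum_nat_const cF mulSn addnC mulnC leq_add2r sum_components_le.
Qed.

Lemma rooted_forests_le k : (0 < #|V|)%N ->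
  #|rooted_forests E k.+1|%:R <= #|rooted_forests E 1|%:R * exp_coeff b^-1 k.
Proof.
move=> V_gt0; elim: k => [|k IHk].
  by rewrite /exp_coeff /= expr0 fact0 divr1 mulr1.
have kb_gt0 : 0 < b * k.+1%:R by rewrite mulr_gt0.
rewrite -(ler_pM2l kb_gt0); apply: le_trans (rooted_forests_ratio _ V_gt0) _.
apply: le_trans IHk _; rewrite le_eqVlt; apply/orP; left; apply/eqP.
rewrite /exp_coeff /= factS natrM exprS invfM; field.
by rewrite nat1r !pnatr_eq0 -lt0n fact_gt0 /= gt_eqF.
Qed.

Lemma rooted_forests_total : (0 < #|V|)%N ->
  #|[set F | rooted_forest E F]|%:R <= #|rooted_forests E 1|%:R * expR b^-1.
Proof.
move=> V_gt0.
apply: le_trans (_ : (\sum_(k < #|V|) #|rooted_forests E k.+1|)%:R <= _).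
  rewrite ler_nat -sum1_card; under [leqRHS]eq_bigr => k _ do
    rewrite -sum1dep_card big_mkcondr.
  rewrite exchange_big /= big_mkcond [leqRHS]big_mkcond /=.
  apply: leq_sum => F _; rewrite inE; case: ifP => // FF.
  have /and3P[_ /spansP spF /eqP cF] := FF.
  have F_gt0 : (0 < #|F.2|)%N.
    have /card_gt0P[v _] := V_gt0; have [s sF _] := spF v.
    by apply/card_gt0P; exists s.
  have F_lt : (#|F.2|.-1 < #|V|)%N by rewrite prednK // -cF leq_addl.
  by rewrite (bigD1 (Ordinal F_lt)) //= prednK // eqxx.
rewrite natr_sum; apply: le_trans (ler_sum _ _) _.
  by move=> k _; exact: rooted_forests_le.
rewrite -mulr_sumr ler_wpM2l ?ler0n //.
rewrite -(big_mkord xpredT (exp_coeff b^-1)).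
apply: nondecreasing_cvgn_le (is_cvg_series_exp_coeff _) _.
apply/nondecreasing_seqP => n; rewrite seriesSr /= lerDl.
by rewrite /exp_coeff /= divr_ge0 ?exprn_ge0 ?ler0n // invr_ge0 ltW.
Qed.

End Expansion.

(** * Spanning trees and rooted forests *)
Section Trees.
Variable n : nat.
Implicit Types (G T : sgraph n) (v : 'I_n).

Lemma edge_card2 G e : e \in edges G -> exists x y, x != y /\ e = [set x; y].
Proof.
move=> eG; have /cards2P[x [y [xy ->]]] := forall_inP (edges_card2 G) e eG.
by exists x, y.
Qed.

(** An edge of T outside H would close a simple path of H into a cycle of T. *)
Lemma acyclic_connected_sub T (H : {set {set 'I_n}}) :
  acyclic T -> H \subset edges T -> (forall x y, connect (eadj H) x y) ->
  edges T \subset H.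
Proof.
move=> acT sHT cH; apply/subsetP => e eT; apply/negPn/negP => eNH.
have [x [y [xy eE]]] := edge_card2 eT; subst e.
have /connectP[p xp yE] := cH x y.
have [q [xq uq _ yq]] : exists q, [/\ path (eadj H) x q, uniq (x :: q),
    {subset q <= p} & y = last x q].
  by move: yE; case/shortenP: xp => q xq uq sq yE; exists q.
apply: (acT (x :: q)).
  case: q xq uq yq => [|z [|t q]] //=.
    by move=> _ _ yx; rewrite yx eqxx in xy.
  by move=> /andP[xz _] _ yz; move: eNH; rewrite yz => /negP.
apply/andP; split=> //; rewrite /= rcons_path -yq.
rewrite (sub_path _ xq) => [|a b]; last exact: (subsetP sHT).
by rewrite /adj setUC.
Qed.

(** A minimal connecting subset of the edges of T has n - 1 elements and, by
    acyclicity, is all of T. *)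
Lemma tree_card T v : is_tree T -> #|edges T|.+1 = n.
Proof.
move=> [/forallP cT acT].
have spT : spans (edges T) [set v].
  by apply/spansP => x; exists v; rewrite ?set11 //; exact: (forallP (cT x)).
have [H [sHT /spansP spH cH]] := spans_subforest spT.
have cHxy x y : connect (eadj H) x y.
  have [s /set1P-> xs] := spH x; have [t /set1P-> yt] := spH y.
  by apply: connect_trans xs _; rewrite econnect_sym.
have HE : H = edges T.
  by apply/eqP; rewrite eqEsubset sHT acyclic_connected_sub.
by rewrite -HE -addn1 -(cards1 v) cH card_ord.
Qed.

(** Removing an edge xy of a cycle keeps the graph connected, through the rest
    of the cycle, and would leave n - 2 edges connecting n vertices. *)
Lemma spans1_is_tree T v : spans (edges T) [set v] ->
  (#|edges T| + 1 = n)%N -> is_tree T.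
Proof.
move=> spT cT; have sym := econnect_sym (edges T); split.
  apply/forallP => x; apply/forallP => y; have /spansP spT' := spT.
  have [s /set1P-> xs] := spT' x; have [t /set1P-> yt] := spT' y.
  by apply: (connect_trans (xs : connect (adj T) x v)); rewrite (sym v).
move=> [|x [|y [|z c]]] // _ /andP[/= /and3P[xy yz zc] /and4P[]].
rewrite !inE !negb_or => /and3P[xNy xNz xNc] /andP[yNz yNc] zNc _.
pose H := edges T :\ [set x; y].
have yNe a b : a != y -> b != y -> [set a; b] != [set x; y].
  move=> aNy bNy; apply/eqP => /setP/(_ y).
  by rewrite !inE eqxx orbT eq_sym (negPf aNy) eq_sym (negPf bNy).
have Hyx : connect (eadj H) y x.
  apply/connectP; exists (z :: rcons c x); rewrite /= ?last_rcons //.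
  rewrite /eadj in_setD1 -/(adj _ _ _) yz andbT; apply/andP; split.
    apply/eqP => /setP/(_ x).
    by rewrite !inE eqxx (negPf xNy) (negPf xNz).
  apply: (sub_in_path (P := predC1 y)) zc => [a b aNy bNy ab|].
    by rewrite /eadj in_setD1 yNe.
  rewrite /= all_rcons /= eq_sym yNz xNy /=.
  by apply/allP => a ac; apply: contraNneq yNc => <-.
have sTH : subrel (connect (eadj (edges T))) (connect (eadj H)).
  apply: connect_sub => a b ab.
  have [abE|abN] := eqVneq [set a; b] [set x; y]; last first.
    by apply: connect1; rewrite /eadj in_setD1 abN.
  have : a \in [set x; y] by rewrite -abE set21.
  have : b \in [set x; y] by rewrite -abE set22.
  rewrite !inE => /orP[]/eqP-> /orP[]/eqP->; rewrite ?connect0 //.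
  by rewrite econnect_sym.
have : spans H [set v].
  apply/spansP => a; have /spansP/(_ a)[s sv as_] := spT.
  by exists s => //; exact: sTH.
move=> /spans_card; rewrite card_ord cards1; move: cT.
rewrite (cardsD1 [set x; y]) (xy : [set x; y] \in edges T) -/H add1n addSn.
by move=> /eq_leq lt1 /(leq_trans lt1); rewrite ltnn.
Qed.

Lemma rooted_forests1_le_trees G :
  #|rooted_forests (edges G) 1| <= n * nb_spanning_trees G.
Proof.
pose f (x : 'I_n * sgraph n) := (edges x.2, [set x.1]).
have -> : n * nb_spanning_trees G = #|setX [set: 'I_n] (spanning_trees G)|.
  by rewrite cardsX cardsT card_ord.
apply: leq_trans (leq_imset_card f _).
apply/subset_leq_card/subsetP => -[H S]; rewrite inE => /andP[/and3P[/=]].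
move=> sHG spH /eqP cH /cards1P[s SE]; subst S.
have H2 : [forall e in H, #|e| == 2].
  apply/forall_inP => e eH; apply: (forall_inP (edges_card2 G)).
  exact: (subsetP sHG).
apply/imsetP; exists (s, SGraph H2) => //.
rewrite inE /= inE /= inE /= sHG; apply/asboolP.
apply: (spans1_is_tree (v := s)) => //=.
by rewrite -[RHS](card_ord n) -cH cards1.
Qed.

(** The rooted forest left by a tree when its vertex v is removed. *)
Definition delete_root v T : {set {set 'I_n.-1}} * {set 'I_n.-1} :=
  (edges (remove_vertex T v), [set i | adj T v (lift v i)]).

Lemma lift_edge v i j : lift v @: [set i; j] = [set lift v i; lift v j].
Proof. by rewrite imsetU !imset_set1. Qed.

Lemma delete_root_sub v T T' :
  delete_root v T = delete_root v T' -> edges T \subset edges T'.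
Proof.
move=> [/setP eqH /setP eqS]; apply/subsetP => e eT.
have nbr i : adj T v (lift v i) -> adj T' v (lift v i).
  by move: (eqS i); rewrite !inE => ->.
have [x [y [xy eE]]] := edge_card2 eT; subst e.
have [xv|xv] := eqVneq x v.
  subst x; have [i /= yi|yv] := unliftP v y; last by rewrite yv eqxx in xy.
  by subst y; exact: nbr.
have [yv|yv] := eqVneq y v.
  subst y; have [i /= xi|xv'] := unliftP v x; last by rewrite xv' eqxx in xv.
  by subst x; rewrite setUC; apply: nbr; rewrite /adj setUC.
have [i /= xi|xv'] := unliftP v x; last by rewrite xv' eqxx in xv.
have [j /= yj|yv'] := unliftP v y; last by rewrite yv' eqxx in yv.
by subst x y; move: (eqH [set i; j]); rewrite !inE lift_edge eT => <-.
Qed.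

Lemma delete_root_inj v : injective (delete_root v).
Proof.
move=> T T' eqd; apply: val_inj; apply/eqP; rewrite eqEsubset.
by rewrite (delete_root_sub eqd) (delete_root_sub (esym eqd)).
Qed.

(** The walk from a vertex to v in T first meets a neighbour of v, which is a
    root. The edges of T away from v and those at v account for the edges and
    the roots of the forest, so |H| + |S| is at most the number n - 1 of edges
    of T. *)
Lemma delete_root_forest v T : is_tree T ->
  spans (delete_root v T).1 (delete_root v T).2 /\
  #|(delete_root v T).1| + #|(delete_root v T).2| = #|'I_n.-1|.
Proof.
move=> treeT; have spF : spans (delete_root v T).1 (delete_root v T).2.
  apply/spansP => u; have [/forallP/(_ (lift v u))/forallP/(_ v) uv _] := treeT.
  have /connectP[p] := uv; elim: p u {uv} => [|z p IHp] u /=.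
    by move=> _ vu; case/eqP: (neq_lift v u).
  move=> /andP[uz zp] vE; have [w /= zw|zv] := unliftP v z; last first.
    by subst z; exists u; rewrite ?connect0 // inE /adj setUC.
  subst z; have [s sS ws] := IHp w zp vE; exists s => //.
  by apply: connect_trans ws; apply: connect1; rewrite /eadj inE lift_edge.
split=> //; apply/eqP; rewrite eqn_leq spans_card // andbT card_ord.
have cT := tree_card v treeT.
set H := _.1; set S := _.2.
apply: leq_trans (eq_leq (congr1 predn cT)) => /=.
have fI : injective (fun e : {set 'I_n.-1} => lift v @: e).
  exact/imset_inj/lift_inj.
have gI : injective (fun i => [set v; lift v i]).
  move=> i j ijE; apply: (@lift_inj _ v).
  have : lift v i \in [set v; lift v j] by rewrite -ijE set22.
  by rewrite !inE eq_sym (negPf (neq_lift v i)) => /eqP.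
rewrite -(card_imset H fI) -(card_imset S gI).
rewrite -cardsUI (_ : _ :&: _ = set0) ?cards0 ?addn0.
  apply/subset_leq_card/subsetP => e /setUP[] /imsetP[a].
    by rewrite inE => aT ->.
  by rewrite inE => aT ->.
apply/setP => e; rewrite !inE; apply/negP => /andP[/imsetP[a _ ->]].
move=> /imsetP[i _] /setP/(_ v); rewrite !inE eqxx /= => /imsetP[j _ /eqP].
by rewrite (negPf (neq_lift v j)).
Qed.

Lemma nb_spanning_trees_le_forests G v :
  nb_spanning_trees G <=
    #|[set F | rooted_forest (edges (remove_vertex G v)) F]|.
Proof.
rewrite /nb_spanning_trees -(card_imset _ (@delete_root_inj v)).
apply/subset_leq_card/subsetP => _ /imsetP[T TG ->].
have /andP[/subsetP sTG /asboolP treeT] :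
    (edges T \subset edges G) && `[< is_tree T >].
  by rewrite inE in TG.
rewrite inE.
have [spF cF] := delete_root_forest v treeT.
rewrite /rooted_forest spF cF eqxx !andbT; apply/subsetP => e.
by rewrite !inE => /sTG.
Qed.

End Trees.

(** * The second eigenvalue of a symmetric matrix *)
Section Spectrum.
Variable R : realType.
Local Open Scope ring_scope.
Local Open Scope sesquilinear_scope.
Local Notation toC := (real_complex R).

Lemma char_poly_similar (F : fieldType) n (P A : 'M[F]_n) :
  P \in unitmx -> char_poly (invmx P *m A *m P) = char_poly A.
Proof.
move=> uP; have PP : map_mx polyC (invmx P) *m map_mx polyC P = 1%:M.
  by rewrite -map_mxM mulVmx // map_mx1.
rewrite /char_poly /char_poly_mx !map_mxM.
rewrite [in LHS](_ : 'X%:M =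
    map_mx polyC (invmx P) *m 'X%:M *m map_mx polyC P); last first.
  by rewrite scalar_mxC -mulmxA PP mulmx1.
by rewrite -mulmxBl -mulmxBr !det_mulmx mulrAC -det_mulmx PP det1 mul1r.
Qed.

(** The unitary matrix has complex entries because the spectral theorem is used
    for the Hermitian matrix that A becomes over the complex numbers. *)
Lemma symmetric_diagonalization n (A : 'M[R]_n) : A^T = A ->
  exists (P : 'M[R[i]]_n) (d : 'I_n -> R), P \is unitarymx /\
    map_mx toC A = P^t* *m diag_mx (\row_i (d i)%:C%C) *m P.
Proof.
move=> symA; pose B := map_mx toC A.
have hB : B \is hermsymmx.
  apply: realsym_hermsym.
    by apply/is_hermitianmxP; rewrite expr0 scale1r map_mx_id // map_trmx symA.
  apply/mxOverP => i j; rewrite mxE; apply/complex_realP; by exists (A i j).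
have /orthomx_spectralP BE := hermitian_normalmx hB.
have /mxOverP realD := hermitian_spectral_diag_real hB.
exists (spectralmx B), (fun i => complex.Re (spectral_diag B 0 i)).
split; first exact: spectral_unitarymx.
apply: (etrans BE); rewrite (invmx_unitary (spectral_unitarymx B)).
congr (_ *m diag_mx _ *m _).
by apply/rowP => i; rewrite mxE RRe_real.
Qed.

Lemma char_poly_diagonalized n (A : 'M[R]_n) (P : 'M[R[i]]_n) (d : 'I_n -> R) :
  P \is unitarymx -> map_mx toC A = P^t* *m diag_mx (\row_i (d i)%:C%C) *m P ->
  char_poly A = \prod_(x <- [seq d i | i <- enum 'I_n]) ('X - x%:P).
Proof.
move=> uP AE; apply: (map_poly_inj toC); rewrite map_char_poly AE.
rewrite -invmx_unitary // char_poly_similar ?unitarymx_unit //.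
rewrite char_poly_trig ?diag_mx_is_trig // big_map big_enum rmorph_prod /=.
apply: eq_bigr => i _; rewrite !mxE eqxx mulr1n.
by rewrite rmorphB /= map_polyX map_polyC.
Qed.

Lemma spectrum_count n (A : 'M[R]_n) x :
  count_mem x (spectrum A) = mup x (char_poly A).
Proof.
rewrite /spectrum; set p := char_poly A.
have p0 : p != 0 by apply: monic_neq0; exact: char_poly_monic.
rewrite count_flatten -map_comp sumnE big_map.
rewrite (eq_bigr (fun y => (if y == x then mup x p else 0)%N)); last first.
  by move=> y _ /=; rewrite count_nseq /=; case: eqP => [->|]; rewrite ?mul1n.
rewrite -big_mkcond big_const_seq iter_addn_0.
have [xr|xr] := boolP (x \in rootsR p).
  rewrite -/(count_mem x _) count_uniq_mem ?xr ?muln1 //.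
  by apply: (sorted_uniq lt_trans ltxx); exact: sorted_roots.
rewrite (count_memPn xr) muln0 mupNroot //.
by have := roots_on_rootsR p0 x; rewrite (negPf xr) in_itv /= => ->.
Qed.

Lemma spectrum_sorted n (A : 'M[R]_n) : pairwise <=%R (spectrum A).
Proof.
rewrite /spectrum; set p := char_poly A.
have : sorted <%R (rootsR p) by exact: sorted_roots.
rewrite sorted_pairwise; last exact: lt_trans.
elim: rootsR => //= y s IHs /andP[ys ss]; rewrite pairwise_cat IHs // andbT.
apply/andP; split.
  apply/allrelP => a b /nseqP[-> _] /flatten_mapP[c cs /nseqP[-> _]].
  exact/ltW/(allP ys).
apply/(pairwiseP y) => i j; rewrite !inE size_nseq => ilt jlt _.
by rewrite !nth_nseq ilt jlt.
Qed.

(** In a sorted list at most one entry lies below the entry of index 1. That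
    this entry is positive ensures that the list is long enough for it not to
    be the default value 0. *)
Lemma eigenvalues_ge n (A : 'M[R]_n) (d : 'I_n -> R) :
  char_poly A = \prod_(x <- [seq d i | i <- enum 'I_n]) ('X - x%:P) ->
  0 < (spectrum A)`_1 ->
  forall i j, i != j -> d i < (spectrum A)`_1 -> (spectrum A)`_1 <= d j.
Proof.
move=> pE; set l := _`_1 => l0 i j ij di; rewrite leNgt; apply/negP => dj.
have perm : perm_eq (spectrum A) [seq d i | i <- enum 'I_n].
  by apply/allP => x _ /=; rewrite spectrum_count pE mu_prod_XsubC.
have : (count (< l) (spectrum A) <= 1)%N.
  have := spectrum_sorted A; move: l0; rewrite /l.
  case: (spectrum A) => [|x [|y s]] //=; first by rewrite ltxx.
  move=> _ /and3P[_ ys _]; rewrite ltxx add0n.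
  rewrite (_ : count _ s = 0%N) ?addn0; first by case: (x < y).
  apply/eqP; rewrite -leqn0 leqNgt -has_count; apply/hasPn => z zs.
  by rewrite -leNgt (allP ys).
rewrite (permP perm) count_map -size_filter; apply/negP; rewrite -ltnNge.
set below := [seq k <- _ | _].
have -> : (1 < size below)%N = (size [:: i; j] <= size below)%N by [].
apply: uniq_leq_size; first by rewrite /= inE ij.
by move=> k; rewrite !inE mem_filter mem_enum andbT => /orP[]/eqP->.
Qed.

(** In an eigenbasis, the null vector o has a nonzero coordinate i0, whose
    eigenvalue is therefore 0; every other eigenvalue is at least the second
    one, which is positive, so o is supported on i0 and a vector x orthogonal
    to o has no coordinate there. *)
Lemma rayleigh_ge n (A : 'M[R]_n) (o x : 'rV[R]_n) :
  A^T = A -> o != 0 -> o *m A = 0 -> x *m o^T = 0 ->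
  0 < (spectrum A)`_1 ->
  (spectrum A)`_1 * (x *m x^T) 0 0 <= (x *m A *m x^T) 0 0.
Proof.
move=> symA o0 oA xo; set l := _`_1 => l0.
have [P [d [uP AE]]] := symmetric_diagonalization symA.
have dl := eigenvalues_ge (char_poly_diagonalized uP AE) l0.
have uP' : P^t* *m P = 1%:M.
  by rewrite -invmx_unitary // mulVmx // unitarymx_unit.
(* The coordinates of u in the eigenbasis. *)
pose co (u : 'rV[R]_n) := map_mx toC u *m P^t*.
have coT (u : 'rV[R]_n) : P *m (map_mx toC u)^T = (co u)^t*.
  rewrite /co trmx_mul map_mxM trmxCK; congr (_ *m _).
  by apply/matrixP => i j; rewrite !mxE; exact: esym (conjc_real _).
have dot (u w : 'rV[R]_n) :
    ((u *m w^T) 0 0)%:C%C = \sum_i co u 0 i * (co w 0 i)^*.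
  have -> : ((u *m w^T) 0 0)%:C%C = map_mx toC (u *m w^T) 0 0.
    by rewrite [RHS]mxE.
  rewrite map_mxM -[map_mx toC u]mulmx1 -uP' mulmxA -mulmxA.
  rewrite -[map_mx toC w^T]map_trmx coT mxE.
  by apply: eq_bigr => i _; rewrite !mxE.
have form (u : 'rV[R]_n) :
    ((u *m A *m u^T) 0 0)%:C%C = \sum_i (d i)%:C%C * (co u 0 i * (co u 0 i)^*).
  have -> : ((u *m A *m u^T) 0 0)%:C%C = map_mx toC (u *m A *m u^T) 0 0.
    by rewrite [RHS]mxE.
  rewrite !map_mxM AE !mulmxA -mulmxA -[map_mx toC u^T]map_trmx coT mxE.
  apply: eq_bigr => i _; rewrite -/(co u) mul_mx_diag !mxE.
  by rewrite mulrAC [RHS]mulrC.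
have cooA i : co o 0 i * (d i)%:C%C = 0.
  have : map_mx toC (o *m A) *m P^t* = 0 by rewrite oA map_mx0 mul0mx.
  rewrite map_mxM AE !mulmxA mulmxtVK // => /rowP/(_ i).
  by rewrite mul_mx_diag !mxE.
have [i0 coi0] : exists i, co o 0 i != 0.
  apply/existsP; apply: contraR o0 => /existsPn coo0; apply/eqP.
  apply: (map_mx_inj (f := toC)).
  rewrite map_mx0 -[LHS]mulmx1 -uP' mulmxA -/(co o) (_ : co o = 0) ?mul0mx //.
  by apply/rowP => i; rewrite [RHS]mxE; apply/eqP; rewrite -[_ == _]negbK coo0.
have di0 : d i0 = 0.
  apply: complexI; have /eqP := cooA i0.
  by rewrite mulf_eq0 (negPf coi0) => /eqP.
have dge i : i != i0 -> l <= d i.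
  by rewrite eq_sym => ii0; apply: dl ii0 _; rewrite di0.
have coo0 i : i != i0 -> co o 0 i = 0.
  move=> /dge di; apply/eqP; have /eqP := cooA i.
  rewrite mulf_eq0 => /orP[//|/eqP/complexI di_eq0].
  by move: (lt_le_trans l0 di); rewrite di_eq0 ltxx.
have cox0 : co x 0 i0 = 0.
  have := dot x o; rewrite xo mxE (bigD1 i0) //= big1 ?addr0.
    move=> /esym/eqP; rewrite mulf_eq0 conjC_eq0 (negPf coi0) orbF.
    by move=> /eqP.
  by move=> i ii0; rewrite coo0 // rmorph0 mulr0.
rewrite -lecR rmorphM /= dot form mulr_sumr; apply: ler_sum => i _.
have [->|ii0] := eqVneq i i0; first by rewrite cox0 !mul0r !mulr0.
by rewrite ler_wpM2r ?mul_conjC_ge0 // lecR dge.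
Qed.

End Spectrum.

(** * Cuts of a graph with a vertex removed *)
Section Laplacian.
Variable R : realType.
Local Open Scope ring_scope.

Lemma adj_sym n (G : sgraph n) : symmetric (adj G).
Proof. exact: eadj_sym. Qed.

Lemma adj_irrefl n (G : sgraph n) i : adj G i i = false.
Proof.
apply/negP => ii; have := forall_inP (edges_card2 G) _ ii.
by rewrite setUid cards1.
Qed.

Lemma laplacian_sym n (G : sgraph n) : (laplacian R G)^T = laplacian R G.
Proof.
apply/matrixP => i j; rewrite !mxE eq_sym adj_sym.
by case: eqP => [->|].
Qed.

Lemma laplacian_mul n (G : sgraph n) (x : 'rV[R]_n) j :
  (x *m laplacian R G) 0 j = \sum_(i | adj G j i) (x 0 j - x 0 i).
Proof.
rewrite sumrB sumr_const mxE (bigD1 j) //= [in LHS]mxE eqxx -mulr_natr.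
rewrite /degree cardsE; congr (_ + _); first by rewrite mul1r mulr_natr.
rewrite -sumrN big_mkcond [RHS]big_mkcond; apply: eq_bigr => i _ /=.
rewrite mxE [adj G i j]adj_sym; case: eqP => [->|_] /=.
  by rewrite adj_irrefl.
by case: ifP => _; rewrite ?mulr0 // mulrN1.
Qed.

Lemma laplacian_const n (G : sgraph n) (a : R) :
  const_mx a *m laplacian R G = 0 :> 'rV_n.
Proof.
apply/rowP => j; rewrite laplacian_mul [RHS]mxE big1 // => i _.
by rewrite !mxE subrr.
Qed.

Lemma remove_vertex_adj n (G : sgraph n) v i j :
  eadj (edges (remove_vertex G v)) i j = adj G (lift v i) (lift v j).
Proof. by rewrite /eadj inE lift_edge. Qed.

(** For a vector x that vanishes at v and is given by f elsewhere, the edges at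
    v contribute the squares of f at the neighbours of v, and the other edges
    the quadratic form of the Laplacian of the smaller graph. *)
Lemma laplacian_form_remove n (G : sgraph n.+1) (v : 'I_n.+1) (f : 'I_n -> R) :
  let x := \row_i oapp f 0 (unlift v i) in
  (x *m laplacian R G *m x^T) 0 0 =
    \sum_i \sum_(j | eadj (edges (remove_vertex G v)) i j) f i * (f i - f j)
    + \sum_(i | adj G v (lift v i)) f i ^+ 2.
Proof.
move=> x; have xv : x 0 v = 0 by rewrite mxE unlift_none.
have xl i : x 0 (lift v i) = f i by rewrite mxE liftK.
rewrite mxE (bigD1_ord v) //= [x^T v 0]mxE xv mulr0 add0r.
rewrite [X in _ = _ + X]big_mkcond -big_split; apply: eq_bigr => i _ /=.
rewrite laplacian_mul [x^T _ _]mxE xl mulrC mulr_sumr big_mkcond.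
rewrite (bigD1_ord v) //= xv subr0 -expr2 addrC adj_sym; congr (_ + _).
rewrite [RHS]big_mkcond; apply: eq_bigr => j _.
by rewrite xl; have /= -> := remove_vertex_adj G v i j.
Qed.

(** This is |V| times the indicator function of A, minus its mean: a test vector
    for the cut of A that is orthogonal to the constants. *)
Definition cut_vector (V : finType) (A : {set V}) (i : V) : R :=
  if i \in A then #|~: A|%:R else - #|A|%:R.

Lemma sum_cut_vector (V : finType) (A : {set V}) (g : R -> R) :
  \sum_i g (cut_vector A i) =
  #|A|%:R * g #|~: A|%:R + #|~: A|%:R * g (- #|A|%:R).
Proof.
rewrite (bigID (mem A)) /=; congr (_ + _).
  rewrite (eq_bigr (fun=> g #|~: A|%:R)) => [|i iA]; last first.
    by rewrite /cut_vector iA.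
  by rewrite sumr_const mulrC mulr_natr.
rewrite (eq_bigr (fun=> g (- #|A|%:R))) => [|i iA]; last first.
  by rewrite /cut_vector (negPf iA).
rewrite (eq_bigl (fun i => i \in ~: A)) => [|i]; last by rewrite inE.
by rewrite sumr_const mulrC mulr_natr.
Qed.

(** Only edges between A and its complement contribute, each of them
    |~: A| |V| from its end in A and |A| |V| from its other end. *)
Lemma cut_vector_form (V : finType) (E : {set {set V}}) (A : {set V}) :
  let f := cut_vector A in
  \sum_i \sum_(j | eadj E i j) f i * (f i - f j) =
  #|V|%:R ^+ 2 * \sum_(i in A) #|[set j | eadj E i j & j \notin A]|%:R.
Proof.
move=> f; set e := \sum_(i in A) _.
set a : R := #|A|%:R; set b : R := #|~: A|%:R.
have abV : a + b = #|V|%:R by rewrite -natrD cardsC.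
have eE : e = \sum_(i in A) \sum_(j in ~: A | eadj E i j) 1.
  apply: eq_bigr => i iA; rewrite sumr_const; congr (_%:R).
  by apply: eq_card => j; rewrite !inE [RHS]unfold_in inE andbC.
rewrite (bigID (mem A)) /=.
have -> : \sum_(i in A) \sum_(j | eadj E i j) f i * (f i - f j) =
          b * #|V|%:R * e.
  rewrite eE mulr_sumr; apply: eq_bigr => i iA; rewrite mulr_sumr.
  rewrite big_mkcond [RHS]big_mkcond; apply: eq_bigr => j _.
  rewrite /f /cut_vector iA inE -/a -/b -abV.
  by case: (j \in A); case: (eadj _ _ _) => //=; ring.
have -> : \sum_(i | i \notin A) \sum_(j | eadj E i j) f i * (f i - f j) =
          a * #|V|%:R * e.
  rewrite eE [X in _ = _ * X](exchange_big_dep (mem (~: A))) /=; last first.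
    by move=> ? ? _ /andP[].
  rewrite mulr_sumr (eq_bigl (fun i => i \in ~: A)) => [|i]; last by rewrite inE.
  apply: eq_bigr => i; rewrite inE => iA; rewrite mulr_sumr.
  rewrite big_mkcond [RHS]big_mkcond; apply: eq_bigr => j _.
  rewrite /f /cut_vector (negPf iA) -/a -/b -abV [eadj E j i]eadj_sym /=.
  by case: (j \in A); case: (eadj _ _ _) => //=; ring.
by rewrite -abV; ring.
Qed.

(** [rayleigh_ge] for the cut vector of A extended by 0 at v. The edges at v
    cost at most the squared norm |A| |~: A| n of the vector, which is why
    the eigenvalue drops by 1. *)
Lemma remove_vertex_cut n (G : sgraph n.+1) (v : 'I_n.+1) (A : {set 'I_n}) :
  0 < algebraic_connectivity R G ->
  (algebraic_connectivity R G - 1) * #|A|%:R * #|~: A|%:R <=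
  n%:R * \sum_(i in A)
    #|[set j | eadj (edges (remove_vertex G v)) i j & j \notin A]|%:R.
Proof.
set l := algebraic_connectivity R G => l0.
set E := edges (remove_vertex G v); set e := \sum_(i in A) _.
set a : R := #|A|%:R; set b : R := #|~: A|%:R.
have abn : a + b = n%:R by rewrite -natrD cardsC card_ord.
pose f := cut_vector A.
pose x : 'rV[R]_n.+1 := \row_i oapp f 0 (unlift v i).
have xv : x 0 v = 0 by rewrite mxE unlift_none.
have xl i : x 0 (lift v i) = f i by rewrite mxE liftK.
pose o : 'rV[R]_n.+1 := const_mx 1.
have o0 : o != 0.
  by apply/eqP => /rowP/(_ 0); rewrite !mxE => /eqP; rewrite oner_eq0.
have xo : x *m o^T = 0.
  apply/matrixP => i j; rewrite ord1 (ord1 j) {i j} [RHS]mxE mxE.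
  rewrite (bigD1_ord v) //= xv mul0r add0r.
  rewrite (eq_bigr (fun i => f i)) => [|i _]; last by rewrite xl !mxE mulr1.
  by rewrite (sum_cut_vector A id); ring.
have xx : (x *m x^T) 0 0 = a * b * n%:R.
  rewrite mxE (bigD1_ord v) //= xv mul0r add0r.
  rewrite (eq_bigr (fun i => f i ^+ 2)) => [|i _]; last first.
    by rewrite [x^T _ _]mxE xl expr2.
  by rewrite (sum_cut_vector A (fun y => y ^+ 2)) -abn; ring.
have := rayleigh_ge (laplacian_sym G) o0 (laplacian_const G 1) xo l0.
rewrite -/(algebraic_connectivity R G) -/l xx laplacian_form_remove.
rewrite (cut_vector_form E A) card_ord -/e => ray.
have nbr : \sum_(i | adj G v (lift v i)) f i ^+ 2 <= a * b * n%:R.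
  rewrite -xx mxE (bigD1_ord v) //= xv mul0r add0r big_mkcond /=.
  apply: ler_sum => i _; rewrite [x^T _ _]mxE xl -expr2.
  by case: ifP => // _; exact: sqr_ge0.
have [n0|n_gt0] := posnP n.
  have /eqP : a + b = 0 by rewrite abn n0.
  rewrite paddr_eq0 ?ler0n // => /andP[/eqP-> _].
  by rewrite mulr0 mul0r n0 mul0r.
have n_gt0R : 0 < n%:R :> R by rewrite ltr0n.
rewrite -(ler_pM2l n_gt0R); lra.
Qed.

End Laplacian.

(** * Removing a vertex from a graph with a large spectral gap *)
Section RemoveVertex.
Variable R : realType.
Local Open Scope ring_scope.

Lemma connected_cut_gt0 n (G : sgraph n) (A : {set 'I_n}) :
  connected G -> (0 < #|A|)%N -> (0 < #|~: A|)%N ->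
  (0 < \sum_(i in A) #|[set j | eadj (edges G) i j & j \notin A]|)%N.
Proof.
move=> /forallP cG /card_gt0P[x xA] /card_gt0P[y yA].
have [|i [j [iA jA ij]]] := connect_crossing (forallP (cG x) y) _ yA.
  by rewrite inE xA.
rewrite !inE negbK in iA jA; rewrite (bigD1 i) //= addn_gt0; apply/orP; left.
by apply/card_gt0P; exists j; rewrite inE (ij : eadj _ _ _).
Qed.

(** The first term of the minimum serves when gamma (n + 1) >= 2, the second one
    when gamma (n + 1) < 2: there every cut has an edge, and
    gamma^2 |A| |~: A| < 4. *)
Lemma remove_vertex_expansion (gamma : R) n (G : sgraph n.+1) (v : 'I_n.+1) :
  0 < gamma -> gamma * n.+1%:R <= algebraic_connectivity R G ->
  (gamma * n.+1%:R <= 1 -> connected (remove_vertex G v)) ->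
  expansion (edges (remove_vertex G v) : {set {set 'I_n}})
    (Num.min (gamma / 2) (gamma ^+ 2 / 4)).
Proof.
move=> gamma_gt0 le_gl conn A.
set E := edges _; set b := Num.min _ _.
(* The number of edges between A and its complement; it matters that this is
   an integer, since below it is only known to be positive. *)
rewrite -natr_sum; set e := (\sum_(i in A) _)%N.
have [->|A0] := posnP #|A|; first by rewrite mulr0 mul0r.
have [->|CA0] := posnP #|~: A|; first by rewrite mulr0.
have N_gt0 : 0 < gamma * n.+1%:R by rewrite mulr_gt0.
have := remove_vertex_cut v A (lt_le_trans N_gt0 le_gl).
rewrite -natr_sum -/E -/e => cut.
have AN : #|A|%:R + #|~: A|%:R = n%:R :> R by rewrite -natrD cardsC card_ord.
have A0R : 1 <= #|A|%:R :> R by rewrite ler1n.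
have CA0R : 1 <= #|~: A|%:R :> R by rewrite ler1n.
move: cut AN A0R CA0R; set x : R := #|A|%:R; set y : R := #|~: A|%:R.
set l := algebraic_connectivity R G in le_gl *.
move=> cut AN x1 y1; have nE : n.+1%:R = x + y + 1 :> R by rewrite -natr1 AN.
rewrite -AN in cut; rewrite nE in le_gl N_gt0 conn.
have xy0 : 0 < x * y by rewrite mulr_gt0 //; lra.
have [large|small] := lerP 2 (gamma * (x + y + 1)).
  have b_le : b <= gamma / 2 by rewrite ge_min lexx.
  have : gamma / 2 * (x * y) <= e%:R.
    rewrite -(@ler_pM2l _ (x + y)); last lra.
    apply: le_trans cut; rewrite [leLHS]mulrA -[leRHS]mulrA ler_pM2r //; nra.
  by apply: le_trans; rewrite -mulrA ler_pM2r.
have b_le : b <= gamma ^+ 2 / 4 by rewrite ge_min lexx orbT.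
apply: le_trans (_ : 1 <= _); last first.
  rewrite ler1n; have [le1|gt1] := lerP (gamma * (x + y + 1)) 1.
    exact: (connected_cut_gt0 (conn le1)).
  rewrite -(ltr0n R) -(@pmulr_rgt0 _ (x + y)); last lra.
  by apply: lt_le_trans cut; rewrite -mulrA mulr_gt0 //; lra.
apply: le_trans (_ : gamma ^+ 2 / 4 * (x * y) <= _).
  by rewrite -mulrA ler_pM2r.
have : (gamma * (x + y + 1)) ^+ 2 <= 4 by nra.
have : gamma ^+ 2 * (x * y) <= (gamma * (x + y + 1)) ^+ 2.
  by rewrite exprMn ler_pM2l ?exprn_gt0 //; nra.
by lra.
Qed.

Lemma nb_spanning_trees_remove_vertex (b : R) n
    (G : sgraph n.+2) (v : 'I_n.+2) :
  0 < b -> expansion (edges (remove_vertex G v) : {set {set 'I_n.+1}}) b ->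
  (nb_spanning_trees G)%:R <=
    expR b^-1 * n.+1%:R * (nb_spanning_trees (remove_vertex G v))%:R.
Proof.
move=> b0 expE; have V0 : (0 < #|'I_n.+1|)%N by rewrite card_ord.
apply: le_trans (_ :
    #|[set F | rooted_forest (edges (remove_vertex G v)) F]|%:R <= _).
  by rewrite ler_nat nb_spanning_trees_le_forests.
apply: le_trans (rooted_forests_total b0 expE V0) _.
rewrite mulrC -mulrA ler_pM2l ?expR_gt0 // -natrM ler_nat.
exact: rooted_forests1_le_trees.
Qed.

End RemoveVertex.

Unset Implicit Arguments.
Local Open Scope ring_scope.

Theorem corollary3p3 (R : realType) (gamma : R) (gamma_gt0 : 0 < gamma) :
  exists c : R, 0 < c /\
    forall (n : nat) (G : sgraph n) (v1 : 'I_n),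
      (2 <= n)%N ->
      gamma * n%:R <= algebraic_connectivity R G ->
      (gamma * n%:R <= 1 -> connected (remove_vertex G v1)) ->
      (nb_spanning_trees G)%:R / (c * n%:R)
        <= (nb_spanning_trees (remove_vertex G v1))%:R :> R.
Proof.
pose b := Num.min (gamma / 2) (gamma ^+ 2 / 4).
have b_gt0 : 0 < b by rewrite lt_min !divr_gt0 ?exprn_gt0.
exists (expR b^-1); split; first exact: expR_gt0.
move=> [|[|n]] // G v _ le_gl conn.
have expE := remove_vertex_expansion gamma_gt0 le_gl conn.
rewrite ler_pdivrMr ?mulr_gt0 ?expR_gt0 // mulrC.
apply: le_trans (nb_spanning_trees_remove_vertex b_gt0 expE) _.
by rewrite ler_wpM2r ?ler0n // ler_pM2l ?expR_gt0 // ler_nat.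
Qed.
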